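(* Let $\mathcal{B}$ be a bicategory with a shadow given by functors $\langle\langle-\rangle\rangle\colon\mathcal{B}(R,R)\to\mathbf{T}$. Let $\mathcal{T}$ be the category $\mathbf{T}$ regarded as a 2-category with only identity 2-cells. There is a strict 2-functor $\chi\colon\Lambda\mathcal{B}\to\mathcal{T}$ defined on 0-cells by $\chi(P)=\langle\langle P\rangle\rangle$, on 1-cells by $\chi[(N,\gamma)]=\mathrm{tr}(\gamma)$, and on 2-cells $\psi$ out of a 1-cell $(N,\gamma)$ by $\chi(\psi)=\mathrm{id}_{\mathrm{tr}(\gamma)}$.
   Context: Composition of 1-cells in a bicategory is written diagrammatically: $M\colon A\to B$ and $N\colon B\to C$ give $M\odot N\colon A\to C$; unit 1-cells are $U_A$; the left and right unitors are $\ell,r$. A 1-cell $M\colon A\to B$ is (right) dualizable if there is a 1-cell $M^*\colon B\to A$ and 2-cells $\eta\colon U_A\to M\odot M^*$, $\epsilon\colon M^*\odot M\to U_B$ satisfying the triangle identities. Shadow: functors $\langle\langle-\rangle\rangle\colon\mathcal{B}(R,R)\to\mathbf{T}$ for each 0-cell $R$, with natural isomorphisms $\theta\colon\langle\langle M\odot N\rangle\rangle\to\langle\langle N\odot M\rangle\rangle$ for $M\colon R\to S$, $N\colon S\to R$, such that (suppressing associators) $\theta\colon\langle\langle M\odot N\odot P\rangle\rangle\to\langle\langle P\odot M\odot N\rangle\rangle$ equals the composite of $\theta$'s through $\langle\langle N\odot P\odot M\rangle\rangle$, and $\langle\langle\ell\rangle\rangle\circ\theta=\langle\langle r\rangle\rangle$,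 $\langle\langle r\rangle\rangle\circ\theta=\langle\langle\ell\rangle\rangle$. Trace: for $M$ dualizable and $f\colon Q\odot M\Rightarrow M\odot P$ (with $Q$, $P$ endomorphism 1-cells), $\mathrm{tr}(f)$ is the composite $\langle\langle Q\rangle\rangle\xrightarrow{\langle\langle\mathrm{id}\odot\eta\rangle\rangle}\langle\langle Q\odot M\odot M^*\rangle\rangle\xrightarrow{\langle\langle f\odot\mathrm{id}\rangle\rangle}\langle\langle M\odot P\odot M^*\rangle\rangle\xrightarrow{\theta}\langle\langle M^*\odot M\odot P\rangle\rangle\xrightarrow{\langle\langle\epsilon\odot\mathrm{id}\rangle\rangle}\langle\langle P\rangle\rangle$ (independent of the choice of dual). $\Lambda\mathcal{B}$ is the bicategory whose 0-cells are the endomorphism 1-cells of $\mathcal{B}$; whose 1-cells from $P\colon V\to V$ to $Q\colon W\to W$ are pairs $(M,\psi)$ with $M\colon V\to W$ dualizable and $\psi\colon P\odot M\Rightarrow M\odot Q$ a 2-cell; and whose 2-cells $(M,\psi)\Rightarrow(M',\psi')$ are isomorphism 2-cells $\beta\colon M\Rightarrow M'$ with $\psi'\circ(\mathrm{id}_P\odot\beta)=(\beta\odot\mathrm{id}_Q)\circ\psi$. Vertical composition, associators and unitors are those of $\mathcal{B}$. The composite of $(M,\beta)\colon P\to Q$ and $(N,\gamma)\colon Q\to T$ is $M\odot N$ with the 2-cell (suppressing associators) $P\odot M\odot N\xrightarrow{\beta\odot\mathrm{id}_N}M\odot Q\odot N\xrightarrow{\mathrm{id}_M\odot\gamma}M\odot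 N\odot T$. The unit at $P\colon V\to V$ is $U_V$ with $P\odot U_V\xrightarrow{r}P\xrightarrow{\ell^{-1}}U_V\odot P$. *)

(* Defs.v *)
From Corelib Require Import ssreflect ssrfun.
From Stdlib Require Import ProofIrrelevance.

Set Implicit Arguments.
Unset Strict Implicit.
Unset Printing Implicit Defensive.

(** Composition is written in diagrammatic order throughout. *)

Record category := Category {
  ob :> Type;
  hom : ob -> ob -> Type;
  id1 : forall a, hom a a;
  comp : forall a b c, hom a b -> hom b c -> hom a c;
  comp1l : forall a b (f : hom a b), comp (id1 a) f = f;
  comp1r : forall a b (f : hom a b), comp f (id1 b) = f;
  compA : forall a b c d (f : hom a b) (g : hom b c) (h : hom c d),
    comp f (comp g h) = comp (comp f g) h }.

Arguments hom {_} _ _.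
Arguments id1 {_} _.
Arguments comp {_ _ _ _} _ _.

Notation "f ;; g" := (comp f g) (at level 61, right associativity).

Definition is_iso (C : category) (a b : C) (f : hom a b) : Prop :=
  exists g : hom b a, f ;; g = id1 a /\ g ;; f = id1 b.

Record iso (C : category) (a b : C) := Iso {
  fwd :> hom a b;
  inv : hom b a;
  fwdK : fwd ;; inv = id1 a;
  invK : inv ;; fwd = id1 b }.

Record functor (C D : category) := Functor {
  fob :> C -> D;
  fmap : forall a b : C, hom a b -> hom (fob a) (fob b);
  fmap1 : forall a, fmap (id1 a) = id1 (fob a);
  fmapM : forall a b c (f : hom a b) (g : hom b c),
    fmap (f ;; g) = fmap f ;; fmap g }.

Reserved Notation "M ⊙ N" (at level 40, left associativity).
Reserved Notation "f ∗ g" (at level 40, left associativity).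

(** The operation [hcomp] on 1-cells (written [⊙]) and the operation [hcomp2] on
    2-cells (written [∗]) together form a functor
    [B x y × B y z -> B x z]. *)
Record bicategory := Bicategory {
  cell0 :> Type;
  cells :> cell0 -> cell0 -> category;
  unit1 : forall x, cells x x;
  hcomp : forall x y z, cells x y -> cells y z -> cells x z
    where "M ⊙ N" := (hcomp M N);
  hcomp2 : forall x y z (M M' : cells x y) (N N' : cells y z),
    hom M M' -> hom N N' -> hom (M ⊙ N) (M' ⊙ N')
    where "f ∗ g" := (hcomp2 f g);
  hcomp2_id : forall x y z (M : cells x y) (N : cells y z),
    id1 M ∗ id1 N = id1 (M ⊙ N);
  hcomp2_comp : forall x y z (M M' M'' : cells x y) (N N' N'' : cells y z)
      (f : hom M M') (f' : hom M' M'') (g : hom N N') (g' : hom N' N''),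
    (f ;; f') ∗ (g ;; g') = (f ∗ g) ;; (f' ∗ g');
  assoc : forall x y z w (M : cells x y) (N : cells y z) (P : cells z w),
    iso (M ⊙ N ⊙ P) (M ⊙ (N ⊙ P));
  lunit : forall x y (M : cells x y), iso (unit1 x ⊙ M) M;
  runit : forall x y (M : cells x y), iso (M ⊙ unit1 y) M;
  assoc_nat : forall x y z w (M M' : cells x y) (N N' : cells y z)
      (P P' : cells z w) (f : hom M M') (g : hom N N') (h : hom P P'),
    (f ∗ g ∗ h) ;; assoc M' N' P' = assoc M N P ;; (f ∗ (g ∗ h));
  lunit_nat : forall x y (M M' : cells x y) (f : hom M M'),
    (id1 (unit1 x) ∗ f) ;; lunit M' = lunit M ;; f;
  runit_nat : forall x y (M M' : cells x y) (f : hom M M'),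
    (f ∗ id1 (unit1 y)) ;; runit M' = runit M ;; f;
  pentagon : forall x y z w v (M : cells x y) (N : cells y z) (P : cells z w)
      (Q : cells w v),
    assoc (M ⊙ N) P Q ;; assoc M N (P ⊙ Q)
    = (assoc M N P ∗ id1 Q) ;; assoc M (N ⊙ P) Q ;; (id1 M ∗ assoc N P Q);
  triangle : forall x y z (M : cells x y) (N : cells y z),
    assoc M (unit1 y) N ;; (id1 M ∗ lunit N) = runit M ∗ id1 N }.

Arguments unit1 {b} x.
Arguments hcomp {b x y z} M N.
Arguments hcomp2 {b x y z M M' N N'} _ _.
Arguments assoc {b x y z w} M N P.
Arguments lunit {b x y} M.
Arguments runit {b x y} M.

Notation "M ⊙ N" := (hcomp M N).
Notation "f ∗ g" := (hcomp2 f g).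

Record right_dual (B : bicategory) (x y : B) (M : B x y) := RightDual {
  dual : B y x;
  coev : hom (unit1 x) (M ⊙ dual);
  ev : hom (dual ⊙ M) (unit1 y);
  dual_triangle1 :
    inv (lunit M) ;; (coev ∗ id1 M) ;; assoc M dual M ;; (id1 M ∗ ev) ;; runit M
    = id1 M;
  dual_triangle2 :
    inv (runit dual) ;; (id1 dual ∗ coev) ;; inv (assoc dual M dual) ;;
      (ev ∗ id1 dual) ;; lunit dual
    = id1 dual }.

Definition dualizable (B : bicategory) (x y : B) (M : B x y) : Prop :=
  inhabited (right_dual M).

Record shadow (B : bicategory) (T : category) := Shadow {
  sh :> forall x : B, functor (B x x) T;
  theta : forall (x y : B) (M : B x y) (N : B y x),
    iso (sh x (M ⊙ N)) (sh y (N ⊙ M));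
  theta_nat : forall (x y : B) (M M' : B x y) (N N' : B y x)
      (f : hom M M') (g : hom N N'),
    fmap (sh x) (f ∗ g) ;; theta M' N' = theta M N ;; fmap (sh y) (g ∗ f);
  theta_hexagon : forall (x y z : B) (M : B x y) (N : B y z) (P : B z x),
    fwd (theta (M ⊙ N) P)
    = fmap (sh x) (assoc M N P) ;; theta M (N ⊙ P) ;;
      fmap (sh y) (assoc N P M) ;; theta N (P ⊙ M) ;;
      fmap (sh z) (assoc P M N);
  theta_lunit : forall (x : B) (M : B x x),
    theta M (unit1 x) ;; fmap (sh x) (lunit M) = fmap (sh x) (runit M);
  theta_runit : forall (x : B) (M : B x x),
    theta (unit1 x) M ;; fmap (sh x) (runit M) = fmap (sh x) (lunit M) }.

(** The trace does not depend on [d], but this is not part of the definition. *)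
Definition trace (B : bicategory) (T : category) (S : shadow B T) (x y : B)
    (M : B x y) (d : right_dual M) (Q : B x x) (P : B y y)
    (f : hom (Q ⊙ M) (M ⊙ P)) : hom (S x Q) (S y P) :=
  fmap (S x) (inv (runit Q) ;; (id1 Q ∗ coev d) ;; inv (assoc Q M (dual d))) ;;
  fmap (S x) (f ∗ id1 (dual d)) ;;
  theta S (M ⊙ P) (dual d) ;;
  fmap (S y) (inv (assoc (dual d) M P) ;; (ev d ∗ id1 P) ;; lunit P).

Section CategoryLemmas.

Context {C : category}.

Lemma comp_post {a b c : C} {f : hom a b} {g : hom b c} {h : hom a c} :
  f ;; g = h -> forall d (k : hom c d), f ;; g ;; k = h ;; k.
Proof. by move=> <- d k; rewrite compA. Qed.

Lemma comp_post3 {a b c c' : C} {f : hom a b} {g : hom b c} {g' : hom c c'}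
    {h : hom a c'} :
  f ;; g ;; g' = h -> forall d (k : hom c' d), f ;; g ;; g' ;; k = h ;; k.
Proof. by move=> <- d k; rewrite -?compA. Qed.

Lemma fwdKc {a b : C} (f : iso a b) d (k : hom a d) : f ;; inv f ;; k = k.
Proof. by rewrite compA fwdK comp1l. Qed.

Lemma invKc {a b : C} (f : iso a b) d (k : hom b d) : inv f ;; f ;; k = k.
Proof. by rewrite compA invK comp1l. Qed.

Lemma iso_monic {a b : C} (f : iso a b) c (g h : hom c a) :
  g ;; f = h ;; f -> g = h.
Proof.
move=> E; rewrite -(comp1r g) -(comp1r h) -(fwdK f) !compA.
by rewrite E.
Qed.

Lemma iso_epic {a b : C} (f : iso a b) c (g h : hom b c) :
  f ;; g = f ;; h -> g = h.
Proof.
by move=> E; rewrite -(comp1l g) -(comp1l h) -(invK f) -?compA E.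
Qed.

Lemma iso_flip {a b c d : C} (f : iso a b) (g : iso c d)
    (h : hom a c) (k : hom b d) :
  h ;; g = f ;; k -> inv f ;; h = k ;; inv g.
Proof.
move=> E; apply: (iso_monic (f := g)); apply: (iso_epic (f := f)).
by rewrite -?compA invK comp1r fwdKc E.
Qed.

Lemma is_iso_id (a : C) : is_iso (id1 a).
Proof. by exists (id1 a); rewrite comp1l. Qed.

Lemma is_iso_comp (a b c : C) (f : hom a b) (g : hom b c) :
  is_iso f -> is_iso g -> is_iso (f ;; g).
Proof.
move=> [f' [Ef Ef']] [g' [Eg Eg']]; exists (g' ;; f').
rewrite -?compA (comp_post Eg) (comp_post Ef') !comp1l; split=> //.
Qed.

Lemma is_iso_fwd (a b : C) (f : iso a b) : is_iso f.
Proof. by exists (inv f); rewrite fwdK invK. Qed.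

Lemma is_iso_inv (a b : C) (f : iso a b) : is_iso (inv f).
Proof. by exists f; rewrite fwdK invK. Qed.

End CategoryLemmas.

Notation "M ◁ f" := (id1 M ∗ f) (at level 40, left associativity).
Notation "f ▷ N" := (f ∗ id1 N) (at level 40, left associativity).

Section BicategoryLemmas.

Context {B : bicategory}.

Lemma lwhisk_comp {x y z : B} (M : B x y) (N N' N'' : B y z)
    (f : hom N N') (g : hom N' N'') : M ◁ (f ;; g) = M ◁ f ;; M ◁ g.
Proof. by rewrite -hcomp2_comp comp1l. Qed.

Lemma rwhisk_comp {x y z : B} (N : B y z) (M M' M'' : B x y)
    (f : hom M M') (g : hom M' M'') : (f ;; g) ▷ N = f ▷ N ;; g ▷ N.
Proof. by rewrite -hcomp2_comp comp1l. Qed.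

Lemma hcomp2_lr {x y z : B} (M M' : B x y) (N N' : B y z)
    (f : hom M M') (g : hom N N') : f ∗ g = f ▷ N ;; M' ◁ g.
Proof. by rewrite -hcomp2_comp comp1l comp1r. Qed.

Lemma hcomp2_rl {x y z : B} (M M' : B x y) (N N' : B y z)
    (f : hom M M') (g : hom N N') : f ∗ g = M ◁ g ;; f ▷ N'.
Proof. by rewrite -hcomp2_comp comp1l comp1r. Qed.

Lemma exch {x y z : B} (M M' : B x y) (N N' : B y z)
    (f : hom M M') (g : hom N N') : f ▷ N ;; M' ◁ g = M ◁ g ;; f ▷ N'.
Proof. by rewrite -hcomp2_lr hcomp2_rl. Qed.

Definition liso {x y z : B} (M : B x y) (N N' : B y z) (f : iso N N') :
  iso (M ⊙ N) (M ⊙ N').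
Proof.
exists (M ◁ f) (M ◁ inv f).
- by rewrite -lwhisk_comp fwdK hcomp2_id.
- by rewrite -lwhisk_comp invK hcomp2_id.
Defined.

Definition riso {x y z : B} (N : B y z) (M M' : B x y) (f : iso M M') :
  iso (M ⊙ N) (M' ⊙ N).
Proof.
exists (f ▷ N) (inv f ▷ N).
- by rewrite -rwhisk_comp fwdK hcomp2_id.
- by rewrite -rwhisk_comp invK hcomp2_id.
Defined.

Lemma rwhisk_fwdK {x y z : B} (N : B y z) (M M' : B x y) (f : iso M M')
    K (k : hom (M ⊙ N) K) : f ▷ N ;; inv f ▷ N ;; k = k.
Proof. exact: (fwdKc (riso N f)). Qed.

Lemma rwhisk_invK {x y z : B} (N : B y z) (M M' : B x y) (f : iso M M')
    K (k : hom (M' ⊙ N) K) : inv f ▷ N ;; f ▷ N ;; k = k.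
Proof. exact: (invKc (riso N f)). Qed.

Lemma lwhisk_fwdK {x y z : B} (M : B x y) (N N' : B y z) (f : iso N N')
    K (k : hom (M ⊙ N) K) : M ◁ f ;; M ◁ inv f ;; k = k.
Proof. exact: (fwdKc (liso M f)). Qed.

Lemma lwhisk_invK {x y z : B} (M : B x y) (N N' : B y z) (f : iso N N')
    K (k : hom (M ⊙ N') K) : M ◁ inv f ;; M ◁ f ;; k = k.
Proof. exact: (invKc (liso M f)). Qed.

Lemma is_iso_hcomp2 {x y z : B} (M M' : B x y) (N N' : B y z)
    (f : hom M M') (g : hom N N') : is_iso f -> is_iso g -> is_iso (f ∗ g).
Proof.
move=> [f' [Ef Ef']] [g' [Eg Eg']]; exists (f' ∗ g').
by rewrite -!hcomp2_comp Ef Ef' Eg Eg' !hcomp2_id.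
Qed.

Lemma assoc_l {x y z w : B} (M M' : B x y) (N : B y z) (P : B z w)
    (f : hom M M') : f ▷ N ▷ P ;; assoc M' N P = assoc M N P ;; f ▷ (N ⊙ P).
Proof. by rewrite assoc_nat hcomp2_id. Qed.

Lemma assoc_m {x y z w : B} (M : B x y) (N N' : B y z) (P : B z w)
    (f : hom N N') : M ◁ f ▷ P ;; assoc M N' P = assoc M N P ;; M ◁ (f ▷ P).
Proof. by rewrite assoc_nat. Qed.

Lemma assoc_r {x y z w : B} (M : B x y) (N : B y z) (P P' : B z w)
    (f : hom P P') :
  (M ⊙ N) ◁ f ;; assoc M N P' = assoc M N P ;; M ◁ (N ◁ f).
Proof. by rewrite -assoc_nat hcomp2_id. Qed.

Lemma assocV_l {x y z w : B} (M M' : B x y) (N : B y z) (P : B z w)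
    (f : hom M M') :
  inv (assoc M N P) ;; f ▷ N ▷ P = f ▷ (N ⊙ P) ;; inv (assoc M' N P).
Proof. by apply: iso_flip; rewrite assoc_l. Qed.

Lemma assocV_m {x y z w : B} (M : B x y) (N N' : B y z) (P : B z w)
    (f : hom N N') :
  inv (assoc M N P) ;; M ◁ f ▷ P = M ◁ (f ▷ P) ;; inv (assoc M N' P).
Proof. by apply: iso_flip; rewrite assoc_m. Qed.

Lemma assocV_r {x y z w : B} (M : B x y) (N : B y z) (P P' : B z w)
    (f : hom P P') :
  inv (assoc M N P) ;; (M ⊙ N) ◁ f = M ◁ (N ◁ f) ;; inv (assoc M N P').
Proof. by apply: iso_flip; rewrite assoc_r. Qed.

Lemma pentagonV {x y z w v : B} (M : B x y) (N : B y z) (P : B z w) (Q : B w v) :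
  inv (assoc M N P) ▷ Q ;; assoc (M ⊙ N) P Q
  = assoc M (N ⊙ P) Q ;; M ◁ assoc N P Q ;; inv (assoc M N (P ⊙ Q)).
Proof.
apply: (iso_epic (f := riso Q (assoc M N P))).
apply: (iso_monic (f := assoc M N (P ⊙ Q))).
rewrite -?compA invK comp1r /= compA -rwhisk_comp fwdK hcomp2_id comp1l.
exact: pentagon.
Qed.

Lemma pentagonI {x y z w v : B} (M : B x y) (N : B y z) (P : B z w) (Q : B w v) :
  inv (assoc M N (P ⊙ Q)) ;; inv (assoc (M ⊙ N) P Q)
  = M ◁ inv (assoc N P Q) ;; inv (assoc M (N ⊙ P) Q) ;; inv (assoc M N P) ▷ Q.
Proof.
apply: (iso_monic (f := assoc (M ⊙ N) P Q)).
rewrite -?compA invK comp1r pentagonV invKc compA -lwhisk_comp invK hcomp2_id.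
by rewrite comp1l.
Qed.

Lemma pentagonK {x y z w v : B} (M : B x y) (N : B y z) (P : B z w) (Q : B w v) :
  inv (assoc (M ⊙ N) P Q) ;; assoc M N P ▷ Q ;; assoc M (N ⊙ P) Q
  = assoc M N (P ⊙ Q) ;; M ◁ inv (assoc N P Q).
Proof.
apply: (iso_epic (f := assoc (M ⊙ N) P Q)).
apply: (iso_monic (f := liso M (assoc N P Q))) => /=.
rewrite fwdKc -?compA -pentagon -lwhisk_comp invK hcomp2_id comp1r.
by [].
Qed.

Lemma pentagonI' {x y z w v : B} (M : B x y) (N : B y z) (P : B z w) (Q : B w v) :
  inv (assoc M (N ⊙ P) Q) ;; inv (assoc M N P) ▷ Q
  = M ◁ assoc N P Q ;; inv (assoc M N (P ⊙ Q)) ;; inv (assoc (M ⊙ N) P Q).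
Proof. by rewrite pentagonI lwhisk_fwdK. Qed.

Lemma pentagonK' {x y z w v : B} (M : B x y) (N : B y z) (P : B z w) (Q : B w v) :
  inv (assoc (M ⊙ N) P Q) ;; assoc M N P ▷ Q
  = assoc M N (P ⊙ Q) ;; M ◁ inv (assoc N P Q) ;; inv (assoc M (N ⊙ P) Q).
Proof.
apply: (iso_monic (f := assoc M (N ⊙ P) Q)).
by rewrite -?compA invK comp1r pentagonK.
Qed.

Lemma unit_faithful {x y : B} (M N : B x y) (f g : hom M N) :
  unit1 x ◁ f = unit1 x ◁ g -> f = g.
Proof.
move=> E; apply: (iso_epic (f := lunit M)).
by rewrite -!lunit_nat E.
Qed.

Lemma unit_faithful_r {x y : B} (M N : B x y) (f g : hom M N) :
  f ▷ unit1 y = g ▷ unit1 y -> f = g.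
Proof.
move=> E; apply: (iso_epic (f := runit M)).
by rewrite -!runit_nat E.
Qed.

Lemma lunit_hcomp {x y z : B} (M : B x y) (N : B y z) :
  assoc (unit1 x) M N ;; lunit (M ⊙ N) = lunit M ▷ N.
Proof.
apply: unit_faithful; rewrite lwhisk_comp.
apply: (iso_epic (f := assoc _ _ _)).
apply: (iso_epic (f := riso _ (assoc _ _ _))) => /=.
transitivity (assoc (unit1 x ⊙ unit1 x) M N ;; runit (unit1 x) ▷ (M ⊙ N)).
  by rewrite -triangle (comp_post (pentagon _ _ _ _)) -?compA.
by rewrite -assoc_m compA -rwhisk_comp triangle assoc_l.
Qed.

Lemma runit_hcomp {x y z : B} (M : B x y) (N : B y z) :
  assoc M N (unit1 z) ;; M ◁ runit N = runit (M ⊙ N).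
Proof.
apply: unit_faithful_r; rewrite rwhisk_comp.
apply: (iso_monic (f := assoc _ _ _)).
rewrite -?compA assoc_m -(triangle (M ⊙ N)) -compA assoc_r.
by rewrite (comp_post (pentagon _ _ _ _)) -?compA -lwhisk_comp triangle.
Qed.

Lemma lunit_unit (x : B) : fwd (lunit (unit1 x)) = runit (unit1 x).
Proof.
apply: unit_faithful_r; rewrite -triangle -lunit_hcomp; congr comp.
by apply: (iso_monic (f := lunit (unit1 x))); rewrite lunit_nat.
Qed.

Lemma lunit_hcompV {x y z : B} (M : B x y) (N : B y z) :
  inv (assoc (unit1 x) M N) ;; lunit M ▷ N = lunit (M ⊙ N).
Proof. by rewrite -lunit_hcomp invKc. Qed.

Lemma triangleV {x y z : B} (M : B x y) (N : B y z) :
  inv (assoc M (unit1 y) N) ;; runit M ▷ N = M ◁ lunit N.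
Proof. by rewrite -triangle invKc. Qed.

Lemma triangleI {x y z : B} (M : B x y) (N : B y z) :
  inv (runit M) ▷ N ;; assoc M (unit1 y) N = M ◁ inv (lunit N).
Proof.
apply: (iso_monic (f := liso M (lunit N))) => /=.
by rewrite -compA triangle -rwhisk_comp -lwhisk_comp !invK !hcomp2_id.
Qed.

Lemma runit_hcompI {x y z : B} (M : B x y) (N : B y z) :
  inv (runit (M ⊙ N)) ;; assoc M N (unit1 z) = M ◁ inv (runit N).
Proof.
apply: (iso_monic (f := liso M (runit N))) => /=.
by rewrite -compA runit_hcomp -lwhisk_comp !invK hcomp2_id.
Qed.

Lemma lunit_hcompI {x y z : B} (M : B x y) (N : B y z) :
  inv (lunit (M ⊙ N)) ;; inv (assoc (unit1 x) M N) = inv (lunit M) ▷ N.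
Proof.
apply: (iso_monic (f := riso N (lunit M))) => /=.
by rewrite -compA lunit_hcompV -rwhisk_comp !invK hcomp2_id.
Qed.

Lemma runit_natV {x y : B} (M M' : B x y) (f : hom M M') :
  f ;; inv (runit M') = inv (runit M) ;; f ▷ unit1 y.
Proof. by rewrite (iso_flip (runit_nat f)). Qed.

End BicategoryLemmas.

Section Duals.

Context {B : bicategory}.

Lemma dualizable_unit (x : B) : dualizable (unit1 x).
Proof.
constructor; exists (unit1 x) (inv (lunit (unit1 x))) (fwd (lunit (unit1 x))).
- rewrite (comp_post (triangle _ _)) -lunit_unit.
  by rewrite rwhisk_invK invK.
- rewrite {1}lunit_unit (comp_post (triangleV _ _)) lwhisk_invK.
  by rewrite lunit_unit invK.
Qed.

(** The unit and counit of a dual pair, as transformations between the functors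
    [(-) ⊙ M] and [(-) ⊙ dual]. *)
Definition coevX {x y z : B} (M : B x y) (d : right_dual M) (X : B z x) :
    hom X (X ⊙ M ⊙ dual d) :=
  inv (runit X) ;; X ◁ coev d ;; inv (assoc X M (dual d)).

Definition evX {x y z : B} (M : B x y) (d : right_dual M) (Y : B z y) :
    hom (Y ⊙ dual d ⊙ M) Y :=
  assoc Y (dual d) M ;; Y ◁ ev d ;; runit Y.

Lemma coevX_nat {x y z : B} (M : B x y) (d : right_dual M) (X X' : B z x)
    (f : hom X X') :
  f ;; coevX d X' = coevX d X ;; f ▷ M ▷ dual d.
Proof.
rewrite /coevX -?compA assocV_l (comp_post (runit_natV f)) -?compA.
by rewrite (comp_post (exch _ _)) -?compA.
Qed.

Lemma evX_nat {x y z : B} (M : B x y) (d : right_dual M) (Y Y' : B z y)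
    (f : hom Y Y') :
  f ▷ dual d ▷ M ;; evX d Y' = evX d Y ;; f.
Proof.
rewrite /evX -?compA -runit_nat (comp_post (assoc_l _ _ _)) -?compA.
by rewrite (comp_post (exch _ _)) -?compA.
Qed.

Lemma coevX_evX {x y z : B} (M : B x y) (d : right_dual M) (X : B z x) :
  coevX d X ▷ M ;; evX d (X ⊙ M) = id1 (X ⊙ M).
Proof.
rewrite /coevX /evX !rwhisk_comp -?compA.
rewrite (comp_post (pentagonV _ _ _ _)) -?compA (comp_post (assocV_r _ _ _)).
rewrite -runit_hcomp -?compA invKc (comp_post (assoc_m _ _ _)) -?compA.
rewrite (comp_post (triangleI _ _)) -!lwhisk_comp.
by rewrite dual_triangle1 hcomp2_id.
Qed.

Lemma evX_coevX {x y z : B} (M : B x y) (d : right_dual M) (Y : B z y) :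
  coevX d (Y ⊙ dual d) ;; evX d Y ▷ dual d = id1 (Y ⊙ dual d).
Proof.
rewrite /coevX /evX !rwhisk_comp -?compA.
rewrite -triangle (comp_post (assoc_m _ _ _)) -?compA.
rewrite (comp_post3 (pentagonK _ _ _ _)) -?compA.
rewrite (comp_post (assoc_r _ _ _)) -?compA (comp_post (runit_hcompI _ _)).
by rewrite -!lwhisk_comp dual_triangle2 hcomp2_id.
Qed.

Definition coev_hcomp {x y z : B} (M : B x y) (N : B y z)
    (d : right_dual M) (e : right_dual N) :
    hom (unit1 x) (M ⊙ N ⊙ (dual e ⊙ dual d)) :=
  coev d ;; coevX e M ▷ dual d ;; assoc (M ⊙ N) (dual e) (dual d).

Definition ev_hcomp {x y z : B} (M : B x y) (N : B y z)
    (d : right_dual M) (e : right_dual N) :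
    hom (dual e ⊙ dual d ⊙ (M ⊙ N)) (unit1 z) :=
  inv (assoc (dual e ⊙ dual d) M N) ;; evX d (dual e) ▷ N ;; ev e.

Lemma evX_hcomp {w x y z : B} (X : B w x) (Y : B x y) (M : B z y)
    (d : right_dual M) :
  assoc X Y (dual d) ▷ M ;; assoc X (Y ⊙ dual d) M ;; X ◁ evX d Y
  = evX d (X ⊙ Y).
Proof.
rewrite /evX !lwhisk_comp -runit_hcomp (comp_post (assoc_r _ _ _)) -?compA.
by rewrite (comp_post (pentagon _ _ _ _)) -?compA.
Qed.

Lemma coevX_hcomp {w x y z : B} (X : B w x) (Y : B x y) (M : B y z)
    (d : right_dual M) :
  coevX d (X ⊙ Y) ;; assoc X Y M ▷ dual d
  = X ◁ coevX d Y ;; inv (assoc X (Y ⊙ M) (dual d)).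
Proof.
apply: (iso_monic (f := assoc X (Y ⊙ M) (dual d))).
rewrite -?compA invK comp1r /coevX !lwhisk_comp -?compA pentagonK.
by rewrite (comp_post (assoc_r _ _ _)) -?compA (comp_post (runit_hcompI _ _)).
Qed.

Lemma ev_hcompX {w x y z : B} (X : B w z) (M : B x y) (N : B y z)
    (d : right_dual M) (e : right_dual N) :
  assoc X (dual e ⊙ dual d) (M ⊙ N) ;; X ◁ ev_hcomp d e ;; runit X
  = inv (assoc X (dual e) (dual d)) ▷ (M ⊙ N) ;;
    inv (assoc (X ⊙ dual e ⊙ dual d) M N) ;;
    evX d (X ⊙ dual e) ▷ N ;; evX e X.
Proof.
rewrite -(evX_hcomp X) /ev_hcomp [evX e X]/evX.
move: (evX d (dual e)) => k; rewrite !lwhisk_comp !rwhisk_comp -?compA.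
rewrite (comp_post (assoc_m _ _ _)) -?compA.
rewrite (comp_post (assocV_l _ _ _)) -?compA.
rewrite rwhisk_invK (comp_post3 (pentagonK _ _ _ _)).
by rewrite -?compA.
Qed.

Lemma coev_hcompX {w x y z : B} (X : B w x) (M : B x y) (N : B y z)
    (d : right_dual M) (e : right_dual N) :
  inv (runit X) ;; X ◁ coev_hcomp d e ;;
    inv (assoc X (M ⊙ N) (dual e ⊙ dual d))
  = coevX d X ;; coevX e (X ⊙ M) ▷ dual d ;;
    assoc X M N ▷ dual e ▷ dual d ;; assoc (X ⊙ (M ⊙ N)) (dual e) (dual d).
Proof.
rewrite (comp_post (esym (rwhisk_comp _ _ _))) coevX_hcomp /coev_hcomp.
rewrite [coevX d X]/coevX; move: (coevX e M) => k.
rewrite !(lwhisk_comp, rwhisk_comp) -?compA pentagonV.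
by rewrite (comp_post (assocV_m _ _ _)) -?compA invKc.
Qed.

Lemma triangle1_hcomp {x y z : B} (M : B x y) (N : B y z)
    (d : right_dual M) (e : right_dual N) :
  inv (lunit (M ⊙ N)) ;; coev_hcomp d e ▷ (M ⊙ N) ;;
    assoc (M ⊙ N) (dual e ⊙ dual d) (M ⊙ N) ;; M ⊙ N ◁ ev_hcomp d e ;;
    runit (M ⊙ N)
  = id1 (M ⊙ N).
Proof.
rewrite ev_hcompX /coev_hcomp.
move: (evX_nat d (coevX e M)) (coevX_evX e M).
move: (coevX e M) (evX d (M ⊙ N ⊙ dual e)) (evX e (M ⊙ N)) => u v v' Ev Ev'.
rewrite !rwhisk_comp -?compA rwhisk_fwdK.
rewrite (comp_post (esym (assocV_l _ _ (u ▷ _)))) -?compA.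
rewrite (comp_post (esym (assocV_l _ _ (coev d)))) -?compA.
rewrite (comp_post (lunit_hcompI _ _)).
rewrite (comp_post (esym (rwhisk_comp _ _ v))) Ev.
rewrite rwhisk_comp -?compA Ev' comp1r -!rwhisk_comp.
by rewrite /evX -?compA dual_triangle1 hcomp2_id.
Qed.

Lemma triangle2_hcomp {x y z : B} (M : B x y) (N : B y z)
    (d : right_dual M) (e : right_dual N) :
  inv (runit (dual e ⊙ dual d)) ;; (dual e ⊙ dual d) ◁ coev_hcomp d e ;;
    inv (assoc (dual e ⊙ dual d) (M ⊙ N) (dual e ⊙ dual d)) ;;
    ev_hcomp d e ▷ (dual e ⊙ dual d) ;; lunit (dual e ⊙ dual d)
  = id1 (dual e ⊙ dual d).
Proof.
rewrite (comp_post3 (coev_hcompX _ _ _)) /ev_hcomp.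
move: (evX_coevX d (dual e)) (coevX_nat e (evX d (dual e))).
move: (evX d (dual e)) (coevX d (_ ⊙ dual d)) => v u.
move: (coevX e (dual e ⊙ dual d ⊙ M)) => u' Eu Eu'.
rewrite -?compA (comp_post (esym (assoc_l _ _ (_ ;; _)))) -?compA lunit_hcomp.
rewrite -!rwhisk_comp (rwhisk_comp (dual e)) -?compA rwhisk_fwdK.
rewrite (rwhisk_comp (dual e)) -?compA (comp_post (esym Eu')) /coevX -?compA.
by rewrite dual_triangle2 comp1r Eu.
Qed.

Lemma dualizable_hcomp {x y z : B} (M : B x y) (N : B y z) :
  dualizable M -> dualizable N -> dualizable (M ⊙ N).
Proof.
move=> [d] [e]; constructor.
exact: (RightDual (triangle1_hcomp d e) (triangle2_hcomp d e)).
Qed.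

End Duals.

(** [Lambda B] is the bicategory of endomorphism 1-cells [P] of [B].  A 1-cell
    carries the mere existence of a dual, not a chosen one; a 2-cell is an
    isomorphism of [B] compatible with the twistings [tw2]. *)
Record endo (B : bicategory) := Endo { base : B; arr :> B base base }.

Record twisted (B : bicategory) (P Q : endo B) := Twisted {
  tw :> B (base P) (base Q);
  tw_dualizable : dualizable tw;
  tw2 : hom (P ⊙ tw) (tw ⊙ Q) }.

Definition twisted_hom (B : bicategory) (P Q : endo B) (M M' : twisted P Q) : Type :=
  {b : hom (tw M) (tw M') | is_iso b /\ P ◁ b ;; tw2 M' = tw2 M ;; b ▷ Q}.

Section Lambda.

Context {B : bicategory}.

Lemma twisted_hom_eq {P Q : endo B} (M M' : twisted P Q)
    (f g : twisted_hom M M') : proj1_sig f = proj1_sig g -> f = g.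
Proof. by case: f g => [f pf] [g pg]; exact: subset_eq_compat. Qed.

Lemma twisted_id_proof {P Q : endo B} (M : twisted P Q) :
  is_iso (id1 (tw M)) /\ P ◁ id1 (tw M) ;; tw2 M = tw2 M ;; id1 (tw M) ▷ Q.
Proof. by split; [exact: is_iso_id | rewrite !hcomp2_id comp1l comp1r]. Qed.

Definition twisted_id {P Q : endo B} (M : twisted P Q) : twisted_hom M M :=
  exist _ (id1 (tw M)) (twisted_id_proof M).

Lemma twisted_vcomp_proof {P Q : endo B} (M M' M'' : twisted P Q)
    (f : twisted_hom M M') (g : twisted_hom M' M'') :
  is_iso (proj1_sig f ;; proj1_sig g) /\
  P ◁ (proj1_sig f ;; proj1_sig g) ;; tw2 M''
  = tw2 M ;; (proj1_sig f ;; proj1_sig g) ▷ Q.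
Proof.
case: f g => [f [If Ef]] [g [Ig Eg]] /=; split; first exact: is_iso_comp.
by rewrite lwhisk_comp rwhisk_comp -?compA Eg (comp_post Ef) -?compA.
Qed.

Definition twisted_vcomp {P Q : endo B} (M M' M'' : twisted P Q)
    (f : twisted_hom M M') (g : twisted_hom M' M'') : twisted_hom M M'' :=
  exist _ (proj1_sig f ;; proj1_sig g) (twisted_vcomp_proof f g).

Definition twisted_cat (P Q : endo B) : category.
Proof.
refine (@Category (twisted P Q) (@twisted_hom B P Q) twisted_id
  (@twisted_vcomp P Q) _ _ _).
- by move=> M M' f; apply: twisted_hom_eq; exact: comp1l.
- by move=> M M' f; apply: twisted_hom_eq; exact: comp1r.
- by move=> M M' M'' M3 f g h; apply: twisted_hom_eq; exact: compA.
Defined.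

Definition twisted_unit (P : endo B) : twisted P P :=
  Twisted (dualizable_unit (base P)) (runit P ;; inv (lunit P)).

Definition twisted_hcomp {P Q T : endo B} (M : twisted P Q) (N : twisted Q T) :
    twisted P T :=
  Twisted (dualizable_hcomp (tw_dualizable M) (tw_dualizable N))
    (inv (assoc P M N) ;; tw2 M ▷ N ;; assoc M Q N ;; M ◁ tw2 N ;;
     inv (assoc M N T)).

Lemma twisted_hcomp2_proof {P Q T : endo B} (M M' : twisted P Q)
    (N N' : twisted Q T) (f : twisted_hom M M') (g : twisted_hom N N') :
  is_iso (proj1_sig f ∗ proj1_sig g) /\
  P ◁ (proj1_sig f ∗ proj1_sig g) ;; tw2 (twisted_hcomp M' N')
  = tw2 (twisted_hcomp M N) ;; (proj1_sig f ∗ proj1_sig g) ▷ T.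
Proof.
case: f g => [f [If Ef]] [g [Ig Eg]] /=; split; first exact: is_iso_hcomp2.
rewrite (hcomp2_lr f g) lwhisk_comp rwhisk_comp -?compA.
rewrite (comp_post (esym (assocV_r _ _ g))) -?compA.
rewrite (comp_post (esym (assocV_m _ _ f))) -?compA; congr comp.
rewrite (comp_post (esym (exch (tw2 M') g))) -?compA.
rewrite (comp_post (esym (rwhisk_comp _ _ _))) Ef rwhisk_comp -?compA.
congr comp.
rewrite (comp_post (assoc_r _ _ g)) -?compA.
rewrite (comp_post (esym (lwhisk_comp _ _ _))) Eg lwhisk_comp -?compA.
rewrite (comp_post (assoc_l _ _ f)) -?compA; congr comp.
rewrite (comp_post (exch f (tw2 N))) -?compA; congr comp.
by rewrite (comp_post (assocV_l _ _ f)) -?compA assocV_m.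
Qed.

Definition twisted_hcomp2 {P Q T : endo B} (M M' : twisted P Q)
    (N N' : twisted Q T) (f : twisted_hom M M') (g : twisted_hom N N') :
    twisted_hom (twisted_hcomp M N) (twisted_hcomp M' N') :=
  exist _ (proj1_sig f ∗ proj1_sig g) (twisted_hcomp2_proof f g).

Lemma twisted_inv_proof {P Q : endo B} (M M' : twisted P Q)
    (f : iso (tw M) (tw M')) :
  P ◁ f ;; tw2 M' = tw2 M ;; f ▷ Q ->
  P ◁ inv f ;; tw2 M = tw2 M' ;; inv f ▷ Q.
Proof. by move/esym; exact: (iso_flip (f := liso P f) (g := riso Q f)). Qed.

Definition twisted_iso {P Q : endo B} (M M' : twisted P Q) (f : iso (tw M) (tw M'))
    (E : P ◁ f ;; tw2 M' = tw2 M ;; f ▷ Q) : @iso (twisted_cat P Q) M M' :=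
  let g : twisted_hom M M' := exist _ (fwd f) (conj (is_iso_fwd f) E) in
  let h : twisted_hom M' M :=
    exist _ (inv f) (conj (is_iso_inv f) (twisted_inv_proof E)) in
  @Iso (twisted_cat P Q) M M' g h
    (@twisted_hom_eq P Q M M (twisted_vcomp g h) (twisted_id M) (fwdK f))
    (@twisted_hom_eq P Q M' M' (twisted_vcomp h g) (twisted_id M') (invK f)).

Lemma twisted_assoc_proof {P Q T V : endo B} (M : twisted P Q) (N : twisted Q T)
    (L : twisted T V) :
  P ◁ assoc M N L ;; tw2 (twisted_hcomp M (twisted_hcomp N L))
  = tw2 (twisted_hcomp (twisted_hcomp M N) L) ;; assoc M N L ▷ V.
Proof.
rewrite /= !(lwhisk_comp, rwhisk_comp) -?compA.
rewrite (comp_post (pentagonI' _ _ _ _)) -?compA; congr comp; congr comp.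
rewrite (comp_post (assocV_l _ _ _)) -?compA; congr comp.
rewrite (comp_post (pentagonK' _ _ _ _)) -?compA; congr comp; congr comp.
rewrite (comp_post (assocV_m _ _ _)) -?compA; congr comp.
rewrite (comp_post (pentagonV _ _ _ _)) -?compA invKc; congr comp.
rewrite (comp_post (assocV_r _ _ _)) -?compA; congr comp.
rewrite (comp_post (pentagonI _ _ _ _)) -?compA.
by rewrite -rwhisk_comp invK hcomp2_id comp1r.
Qed.

Lemma twisted_lunit_proof {P Q : endo B} (M : twisted P Q) :
  P ◁ lunit M ;; tw2 M
  = tw2 (twisted_hcomp (twisted_unit P) M) ;; lunit M ▷ Q.
Proof.
rewrite /= !(lwhisk_comp, rwhisk_comp) -?compA.
rewrite lunit_hcompV lunit_nat (comp_post (lunit_hcomp _ _)) rwhisk_invK.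
by rewrite (comp_post (triangleV _ _)).
Qed.

Lemma twisted_runit_proof {P Q : endo B} (M : twisted P Q) :
  P ◁ runit M ;; tw2 M
  = tw2 (twisted_hcomp M (twisted_unit Q)) ;; runit M ▷ Q.
Proof.
rewrite /= !(lwhisk_comp, rwhisk_comp) -?compA.
rewrite triangleV -lwhisk_comp invK hcomp2_id comp1r runit_hcomp runit_nat.
by rewrite -runit_hcomp -?compA invKc.
Qed.

Definition twisted_assoc {P Q T V : endo B} (M : twisted P Q) (N : twisted Q T)
    (L : twisted T V) :
    @iso (twisted_cat P V) (twisted_hcomp (twisted_hcomp M N) L)
      (twisted_hcomp M (twisted_hcomp N L)) :=
  @twisted_iso P V (twisted_hcomp (twisted_hcomp M N) L)
    (twisted_hcomp M (twisted_hcomp N L)) (assoc M N L)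
    (twisted_assoc_proof M N L).

Definition twisted_lunit {P Q : endo B} (M : twisted P Q) :
    @iso (twisted_cat P Q) (twisted_hcomp (twisted_unit P) M) M :=
  @twisted_iso P Q (twisted_hcomp (twisted_unit P) M) M (lunit M)
    (twisted_lunit_proof M).

Definition twisted_runit {P Q : endo B} (M : twisted P Q) :
    @iso (twisted_cat P Q) (twisted_hcomp M (twisted_unit Q)) M :=
  @twisted_iso P Q (twisted_hcomp M (twisted_unit Q)) M (runit M)
    (twisted_runit_proof M).

(** All structural 2-cells are those of [B]. *)
Definition Lambda : bicategory.
Proof.
refine (@Bicategory (endo B) twisted_cat twisted_unit
  (@twisted_hcomp) (@twisted_hcomp2) _ _
  (@twisted_assoc) (@twisted_lunit) (@twisted_runit) _ _ _ _ _).
- by move=> *; apply: twisted_hom_eq => /=; exact: hcomp2_id.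
- by move=> *; apply: twisted_hom_eq => /=; exact: hcomp2_comp.
- by move=> *; apply: twisted_hom_eq => /=; exact: assoc_nat.
- by move=> *; apply: twisted_hom_eq => /=; exact: lunit_nat.
- by move=> *; apply: twisted_hom_eq => /=; exact: runit_nat.
- by move=> *; apply: twisted_hom_eq => /=; exact: pentagon.
- by move=> *; apply: twisted_hom_eq => /=; exact: triangle.
Defined.

End Lambda.

Arguments Lambda B : clear implicits.

(** The 2-cells of [locally_discrete T] from [f] to [g] are the proofs of [f = g];
    by proof irrelevance there is at most one, so that all are identities. *)
Definition eq_cat (X : Type) : category.
Proof.
refine (@Category X (fun a b => a = b) (fun a => eq_refl)
  (fun a b c f g => eq_trans f g) _ _ _); by move=> *; exact: proof_irrelevance.
Defined.

Lemma eq_cat_irr (X : Type) (a b : X) (f g : @hom (eq_cat X) a b) : f = g.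
Proof. exact: (@proof_irrelevance (a = b)). Qed.

Definition eq_iso (X : Type) (a b : X) (E : a = b) : @iso (eq_cat X) a b.
Proof. by exists E (eq_sym E); exact: eq_cat_irr. Defined.

Definition locally_discrete (T : category) : bicategory.
Proof.
refine (@Bicategory T (fun a b => eq_cat (hom a b)) (@id1 T)
  (fun a b c f g => f ;; g)
  (fun a b c f f' g g' E E' => f_equal2 (fun f g => f ;; g) E E') _ _
  (fun a b c d f g h => eq_iso (esym (compA f g h)))
  (fun a b f => eq_iso (comp1l f))
  (fun a b f => eq_iso (comp1r f)) _ _ _ _ _);
by move=> *; exact: eq_cat_irr.
Defined.

(** The 2-cell induced by an equality of 1-cells. *)
Definition idto (C : category) (a b : C) (E : a = b) : hom a b :=
  match E in _ = c return hom a c with eq_refl => id1 a end.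

(** Composites and units of 1-cells are preserved on the nose.  The constraint
    2-cells are therefore identities; the [idto] below only correct the boundaries
    of the equations between 2-cells, which are not well typed otherwise. *)
Record is_strict_2functor (C D : bicategory) (F0 : C -> D)
    (F : forall x y : C, functor (C x y) (D (F0 x) (F0 y))) : Prop :=
  IsStrict2Functor {
  F_unit : forall x : C, F x x (unit1 x) = unit1 (F0 x);
  F_comp : forall (x y z : C) (M : C x y) (N : C y z),
    F x z (M ⊙ N) = F x y M ⊙ F y z N;
  F_hcomp2 : forall (x y z : C) (M M' : C x y) (N N' : C y z)
      (f : hom M M') (g : hom N N'),
    fmap (F x z) (f ∗ g) ;; idto (F_comp M' N')
    = idto (F_comp M N) ;; (fmap (F x y) f ∗ fmap (F y z) g);
  F_assoc : forall (x y z w : C) (M : C x y) (N : C y z) (P : C z w),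
    fmap (F x w) (assoc M N P) ;; idto (F_comp M (N ⊙ P)) ;;
      F x y M ◁ idto (F_comp N P)
    = idto (F_comp (M ⊙ N) P) ;; idto (F_comp M N) ▷ F z w P ;;
      assoc (F x y M) (F y z N) (F z w P);
  F_lunit : forall (x y : C) (M : C x y),
    fmap (F x y) (lunit M)
    = idto (F_comp (unit1 x) M) ;; idto (F_unit x) ▷ F x y M ;;
      lunit (F x y M);
  F_runit : forall (x y : C) (M : C x y),
    fmap (F x y) (runit M)
    = idto (F_comp M (unit1 y)) ;; F x y M ◁ idto (F_unit y) ;;
      runit (F x y M) }.

(* Main.v *)
(** The trace first rotates all of [M ⊙ P] past the dual of [M].  By the hexagon
    and [theta_lunit] it suffices to rotate [M] alone and then apply the counit on
    the right ([traceE]); in this form the trace of a composite factors by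
    naturality and the pentagon.  Invariance of the trace under isomorphisms
    [b : M => M'] and under the choice of duals follows by sliding [b] around the
    shadow as its mate between the duals. *)

From Corelib Require Import ssreflect ssrfun.
From Stdlib Require Import ClassicalEpsilon.
Require Import Defs.

Set Implicit Arguments.
Unset Strict Implicit.
Unset Printing Implicit Defensive.

(** An instance of coherence, obtained from three pentagons; it reconciles the bracketings left over
    in [coevX_twisted_hcomp]. *)
Lemma assoc_hcomp5 {B : bicategory} {u v w x y z : B} (M : B u v) (N : B v w)
    (T : B w x) (E : B x y) (D : B y z) :
  inv (assoc M (N ⊙ T) E) ▷ D ;; inv (assoc M N T) ▷ E ▷ D ;;
    assoc (M ⊙ N ⊙ T) E D ;; assoc (M ⊙ N) T (E ⊙ D) ;;
    assoc M N (T ⊙ (E ⊙ D)) ;;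
    M ◁ (N ◁ inv (assoc T E D)) ;; M ◁ inv (assoc N (T ⊙ E) D)
  = M ◁ assoc N T E ▷ D ;; assoc M (N ⊙ (T ⊙ E)) D.
Proof.
rewrite (comp_post (pentagon _ _ _ _)) -?compA (comp_post (assoc_r _ _ _)) -?compA.
rewrite (lwhisk_fwdK (liso N (assoc T E D))) (comp_post (pentagon _ _ _ _)).
rewrite -?compA -lwhisk_comp fwdK hcomp2_id comp1r.
do 3 rewrite (comp_post (esym (rwhisk_comp _ _ _))) -?compA; congr comp.
by rewrite (comp_post (pentagonV _ _ _ _)) -?compA invKc invK comp1r.
Qed.

(** * Mates of 2-cells between dualizable 1-cells *)

Section Mate.

Context {B : bicategory} {x y : B} {M M' : B x y}.
Context (d : right_dual M) (d' : right_dual M') (b : hom M M').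

(** The transpose of [b], built from the unit of [d] and the counit of [d']. *)
Definition mate : hom (dual d') (dual d) :=
  coevX d (dual d') ;; (dual d' ◁ b ;; ev d') ▷ dual d ;; lunit (dual d).

Lemma lunit_ev : lunit (dual d) ▷ M ;; ev d = evX d (unit1 y).
Proof.
by rewrite /evX -lunit_unit lunit_nat -lunit_hcomp -?compA.
Qed.

(** Naturality moves the counit of [d] next to the unit of [d] inside the mate, and the two cancel
    by a triangle identity. *)
Lemma ev_mate : mate ▷ M ;; ev d = dual d' ◁ b ;; ev d'.
Proof.
rewrite /mate; move: (dual d' ◁ b ;; ev d') => h.
move: (coevX_evX d (dual d')); move: (coevX d (dual d')) => k Ek.
rewrite 2!rwhisk_comp -?compA lunit_ev evX_nat.
by rewrite (comp_post Ek) comp1l.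
Qed.

Lemma coev_mate : coev d' ;; M' ◁ mate = coev d ;; b ▷ dual d.
Proof.
(* The mate involves [b] only through [dual d' ◁ b ;; ev d'], from which the triangle identity for
   [d'] recovers [b]. *)
have Eb : inv (lunit M) ;; coev d' ▷ M ;; assoc M' (dual d') M ;;
    M' ◁ (dual d' ◁ b ;; ev d') ;; runit M' = b.
  rewrite lwhisk_comp -?compA (comp_post (esym (assoc_r _ _ _))) -?compA.
  rewrite (comp_post (exch _ _)) -?compA.
  rewrite (comp_post (iso_flip (lunit_nat b))) -?compA.
  by rewrite dual_triangle1 comp1r.
(* Writing [coev d] through [coevX] at the unit makes naturality available. *)
have Ecoev : coevX d (unit1 x) ;; lunit M ▷ dual d = coev d.
  rewrite /coevX -?compA lunit_hcompV lunit_nat.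
  by rewrite lunit_unit invKc.
rewrite /mate; move: Eb; move: (dual d' ◁ b ;; ev d') => h <-.
move: (@coevX_nat _ x y x _ d) (coevX_hcomp M' (dual d') d) Ecoev.
move: (@coevX _ x y x _ d) (coevX d (dual d')) => u v u_nat Ev <-.
rewrite -?compA -rwhisk_comp fwdKc !rwhisk_comp.
rewrite (comp_post (esym (u_nat _ _ _))) -?compA (comp_post Ev).
rewrite !lwhisk_comp -?compA.
rewrite (comp_post (assocV_m _ _ _)) -?compA.
by rewrite triangleV.
Qed.

Lemma coevX_mate {z : B} (X : B z x) :
  coevX d' X ;; (X ⊙ M') ◁ mate = coevX d X ;; X ◁ b ▷ dual d.
Proof.
rewrite /coevX -?compA assocV_r (comp_post (esym (lwhisk_comp _ _ _))).
by rewrite coev_mate lwhisk_comp -?compA assocV_m.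
Qed.

End Mate.

(** * Invariance of the trace and its values on units and composites *)

Section Trace.

Context {B : bicategory} {T : category} (S : shadow B T).

(** Write [f] as the conjugate of [f'] by [b]. Before the rotation, [b] becomes its mate and turns
    the unit of [d] into that of [d']; after it, the mate and the inverse of [b] turn the counit of
    [d] into that of [d']. *)
Lemma trace_iso {x y : B} (M M' : B x y) (d : right_dual M) (d' : right_dual M')
    (Q : B x x) (P : B y y) (f : hom (Q ⊙ M) (M ⊙ P)) (f' : hom (Q ⊙ M') (M' ⊙ P))
    (b : hom M M') :
  is_iso b -> Q ◁ b ;; f' = f ;; b ▷ P -> trace S d f = trace S d' f'.
Proof.
move=> [g [bg gb]] E.
have -> : f = Q ◁ b ;; f' ;; g ▷ P.
  by rewrite (comp_post E) -?compA -rwhisk_comp bg hcomp2_id comp1r.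
have Eev : mate d d' b ∗ g ;; ev d = ev d'.
  rewrite hcomp2_rl -?compA ev_mate (comp_post (esym (lwhisk_comp _ _ _))).
  by rewrite gb hcomp2_id comp1l.
have Ecoev := coevX_mate d d' b Q.
rewrite /trace -/(coevX d Q) -/(coevX d' Q) !(compA (fmap (S x) _) (fmap (S x) _)).
move: (coevX d Q) (coevX d' Q) Ecoev => u u' Ecoev; rewrite -!fmapM.
have -> : u ;; (Q ◁ b ;; f' ;; g ▷ P) ▷ dual d
    = u' ;; f' ▷ dual d' ;; (g ▷ P) ∗ mate d d' b.
  rewrite !rwhisk_comp (comp_post (esym Ecoev)) -?compA.
  by rewrite (comp_post (esym (exch f' (mate d d' b)))) -?compA -hcomp2_rl.
rewrite !fmapM -?compA (comp_post (theta_nat S _ _)) -?compA -!fmapM.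
congr (_ ;; _ ;; _ ;; fmap _ _).
rewrite (comp_post (esym (iso_flip (assoc_nat _ _ _)))) -?compA; congr comp.
by rewrite (comp_post (esym (rwhisk_comp _ _ _))) Eev.
Qed.

Lemma trace_indep {x y : B} (M : B x y) (d d' : right_dual M)
    (Q : B x x) (P : B y y) (f : hom (Q ⊙ M) (M ⊙ P)) :
  trace S d f = trace S d' f.
Proof.
apply: (trace_iso d d' (is_iso_id M)).
by rewrite !hcomp2_id comp1l comp1r.
Qed.

Lemma traceE {x y : B} (M : B x y) (d : right_dual M)
    (Q : B x x) (P : B y y) (f : hom (Q ⊙ M) (M ⊙ P)) :
  trace S d f
  = fmap (S x) (coevX d Q ;; f ▷ dual d ;; assoc M P (dual d)) ;;
    theta S M (P ⊙ dual d) ;; fmap (S y) (evX d P).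
Proof.
rewrite /trace -/(coevX d Q); move: (coevX d Q) => u.
rewrite theta_hexagon /evX !fmapM -?compA.
congr (_ ;; _ ;; _ ;; _ ;; _ ;; _).
(* By naturality, rotating [P] past [dual d ⊙ M] and then applying the counit amounts to rotating
   [P] past a unit. *)
rewrite -theta_lunit (comp_post (theta_nat S _ _)) -?compA; congr comp.
by rewrite -!fmapM fwdKc.
Qed.

(** The unit may be taken as its own dual; [theta_lunit] then removes the rotation, and the
    remaining unitors cancel. *)
Lemma trace_unit {x : B} (d : right_dual (unit1 x)) (P : B x x) :
  trace S d (runit P ;; inv (lunit P)) = id1 (S x P).
Proof.
have T1 : inv (lunit (unit1 x)) ;; inv (lunit (unit1 x)) ▷ unit1 x ;;
    assoc (unit1 x) (unit1 x) (unit1 x) ;; unit1 x ◁ lunit (unit1 x) ;;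
    runit (unit1 x) = id1 (unit1 x).
  by rewrite (comp_post (triangle _ _)) -lunit_unit rwhisk_invK invK.
have T2 : inv (runit (unit1 x)) ;; unit1 x ◁ inv (lunit (unit1 x)) ;;
    inv (assoc (unit1 x) (unit1 x) (unit1 x)) ;; lunit (unit1 x) ▷ unit1 x ;;
    lunit (unit1 x) = id1 (unit1 x).
  rewrite {1}lunit_unit (comp_post (triangleV _ _)) lwhisk_invK.
  by rewrite lunit_unit invK.
rewrite (trace_indep d (RightDual T1 T2)) /trace /=.
rewrite (comp_post (lunit_hcompV _ _)) rwhisk_comp !fmapM -?compA.
rewrite (comp_post (theta_lunit S _)) -!fmapM.
rewrite (comp_post (triangleV _ _)) lwhisk_invK (comp_post (runit_nat _)) -?compA.
by rewrite invKc invK fmap1.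
Qed.

(** The part of the trace of a composite that precedes the rotation. *)
Lemma coevX_twisted_hcomp {P Q R : endo B} (M : twisted P Q) (N : twisted Q R)
    (d : right_dual (tw M)) (e : right_dual (tw N)) :
  (inv (runit P) ;; P ◁ coev_hcomp d e ;;
     inv (assoc P (M ⊙ N) (dual e ⊙ dual d))) ;;
    tw2 (twisted_hcomp M N) ▷ (dual e ⊙ dual d) ;;
    assoc (M ⊙ N) R (dual e ⊙ dual d) ;;
    assoc M N (R ⊙ (dual e ⊙ dual d)) ;;
    M ◁ (N ◁ inv (assoc R (dual e) (dual d))) ;;
    M ◁ inv (assoc N (R ⊙ dual e) (dual d))
  = coevX d P ;; tw2 M ▷ dual d ;; assoc M Q (dual d) ;;
    M ◁ ((coevX e Q ;; tw2 N ▷ dual e ;; assoc N R (dual e)) ▷ dual d).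
Proof.
rewrite coev_hcompX; move: (coevX_nat e (tw2 M)) (coevX_hcomp M Q e).
move: (coevX d P) (coevX e (P ⊙ M)) (coevX e (M ⊙ Q)) (coevX e Q).
move=> u v v' v'' Ev Ev'; rewrite -?compA; congr comp.
rewrite (comp_post (esym (assoc_l _ _ _))) /= !rwhisk_comp -?compA.
rewrite (rwhisk_fwdK (riso (dual e) (assoc P M N))) /=.
(* Naturality of the unit of [e] lets [tw2 M] act first. *)
rewrite (comp_post (esym (rwhisk_comp _ v _))) -Ev.
rewrite (rwhisk_comp _ (tw2 M) v') -?compA; congr comp.
rewrite (comp_post (esym (rwhisk_comp _ v' _))) Ev' !rwhisk_comp !lwhisk_comp -?compA.
rewrite (comp_post (esym (assoc_m _ _ _))) -?compA.
rewrite (comp_post (esym (assoc_m _ _ _))) -?compA -assoc_m; congr comp.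
rewrite -assoc_hcomp5.
rewrite (comp_post (esym (rwhisk_comp _ (inv _) _))) assocV_m.
by rewrite rwhisk_comp -?compA.
Qed.

(** With the composite dual, the hexagon splits the rotation of [M ⊙ N] into one of [M] followed by
    one of [N]. Moving the counit of [d] between them separates the two traces. *)
Lemma trace_hcomp {P Q R : endo B} (M : twisted P Q) (N : twisted Q R)
    (d : right_dual (tw M)) (e : right_dual (tw N))
    (de : right_dual (tw (twisted_hcomp M N))) :
  trace S de (tw2 (twisted_hcomp M N)) = trace S d (tw2 M) ;; trace S e (tw2 N).
Proof.
rewrite (trace_indep de (RightDual (triangle1_hcomp d e) (triangle2_hcomp d e))).
rewrite !traceE {1}/coevX {1}/evX [coev _]/= [dual _]/= [ev _]/=.
rewrite ev_hcompX theta_hexagon.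
move: (coevX_twisted_hcomp d e) (evX_hcomp N (R ⊙ dual e) d).
have := evX_nat d (coevX e Q ;; tw2 N ▷ dual e ;; assoc N R (dual e)).
move: (coevX e Q ;; _) => k.
move: (coevX d P) (evX d Q) (evX d (R ⊙ dual e)) (evX d (N ⊙ _)) (evX e R).
move=> u v v' v'' w Ev Eu Ev'.
have Ev2 : assoc N (R ⊙ dual e ⊙ dual d) M ;; N ◁ v'
    = inv (assoc N (R ⊙ dual e) (dual d)) ▷ M ;; v''.
  by rewrite -Ev' rwhisk_invK.
rewrite -?compA -fmapM -?compA (comp_post (esym (assoc_l _ _ _))) -?compA fwdKc.
rewrite (comp_post (esym (rwhisk_comp _ _ v'))) !fmapM -?compA.
(* The counit of [d] passes back across the rotation of [N]. *)
rewrite (comp_post (esym (theta_nat S (id1 N) _))) -?compA lwhisk_comp.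
rewrite (compA (fmap (S (base Q)) _) (fmap _ _)) -fmapM.
rewrite (comp_post (esym (assoc_m _ _ _))) -?compA Ev2 !fmapM -?compA.
do 2 rewrite (comp_post (esym (theta_nat S (id1 M) _))) -?compA.
(* On the right, [k], the part of the trace of [N] before its rotation, passes back across the
   counit of [d], and then across the rotation of [M]. *)
rewrite (compA (fmap _ v) (fmap _ k)) -fmapM -Ev fmapM -?compA.
rewrite (comp_post (esym (theta_nat S (id1 M) _))) -?compA.
move/(congr1 (@fmap _ _ (S (base P)) _ _)): Eu; rewrite !fmapM !compA => Eu.
by do 4 congr (_ ;; _).
Qed.

End Trace.

(** * The strict 2-functor *)

Theorem theorem4p10 (B : bicategory) (T : category) (S : shadow B T) :
  exists chi : forall P Q : endo B,
      functor (Lambda B P Q)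
              (locally_discrete T (S (base P) (arr P)) (S (base Q) (arr Q))),
    @is_strict_2functor (Lambda B) (locally_discrete T)
      (fun P : endo B => S (base P) (arr P)) chi
    /\ (forall (P Q : endo B) (N : Lambda B P Q) (d : right_dual (tw N)),
          chi P Q N = trace S d (tw2 N))
    /\ (forall (P Q : endo B) (N N' : Lambda B P Q) (psi : hom N N')
              (d : right_dual (tw N)),
          existT (fun fg : hom (S (base P) (arr P)) (S (base Q) (arr Q))
                           * hom (S (base P) (arr P)) (S (base Q) (arr Q)) =>
                    @hom (locally_discrete T (S (base P) (arr P))
                                             (S (base Q) (arr Q)))
                         (fst fg) (snd fg))
                 (chi P Q N, chi P Q N') (fmap (chi P Q) psi)
          = existT _ (trace S d (tw2 N), trace S d (tw2 N))
                   (@id1 (locally_discrete T (S (base P) (arr P))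
                                             (S (base Q) (arr Q)))
                         (trace S d (tw2 N)))).
Proof.
(* Only existence of a dual is given, so one is chosen; the predicate is trivial because any dual
   will do. *)
pose dl (P Q : endo B) (N : twisted P Q) : right_dual (tw N) :=
  epsilon (tw_dualizable N) (fun _ => True).
pose tr (P Q : endo B) (N : twisted P Q) := trace S (dl P Q N) (tw2 N).
have trE P Q (N N' : twisted P Q) (psi : twisted_hom N N') : tr P Q N = tr P Q N'.
  by case: psi => b [Ib Eb]; exact: trace_iso Ib Eb.
pose chi (P Q : endo B) : functor (Lambda B P Q)
    (locally_discrete T (S (base P) (arr P)) (S (base Q) (arr Q))) :=
  @Functor (Lambda B P Q) (locally_discrete T _ _) (tr P Q) (trE P Q)
    (fun=> eq_cat_irr _ _) (fun _ _ _ _ _ => eq_cat_irr _ _).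
exists chi; split; last split.
- have chi_unit (P : Lambda B) : chi P P (unit1 P) = id1 (S (base P) (arr P)).
    exact: trace_unit.
  have chi_comp (P Q R : Lambda B) (M : Lambda B P Q) (N : Lambda B Q R) :
      chi P R (M ⊙ N) = chi P Q M ;; chi Q R N.
    exact: trace_hcomp.
  (* The remaining laws equate parallel 2-cells of [locally_discrete T], which always agree. *)
  exists chi_unit chi_comp; by move=> *; exact: eq_cat_irr.
- by move=> P Q N d; exact: trace_indep.
(* The image of [psi] is a proof that the two traces are equal; eliminating it identifies the
   endpoints and leaves the identity. *)
- move=> P Q N N' psi d; rewrite -(trace_indep S (dl P Q N) d).
  move: (fmap (chi P Q) psi); rewrite /= -/(tr P Q N).
  by case: _ /.
Qed.
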